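(* Let $A_1,\dots,A_4,B_1,\dots,B_4\subseteq\mathbf{Z}_{247}$ be the explicit subsets defined in the context. Then the two $988\times 988$ matrices $GS([A_1],[A_2],[A_3],[A_4])$ and $GS([B_1],[B_2],[B_3],[B_4])$, obtained by substituting the circulant matrices $[A_i]$, respectively $[B_i]$, for $P_i$ in the Goethals--Seidel array, are skew-Hadamard matrices of order $988$.
   Context: A Hadamard matrix of order $m$ is an $m\times m$ matrix $A$ with entries in $\{1,-1\}$ such that $AA^T=mI_m$, where $T$ denotes the transpose and $I_m$ the identity matrix. A skew-Hadamard matrix is a Hadamard matrix $A$ such that $A-I_m$ is skew-symmetric. $\mathbf{Z}_n$ denotes the ring of integers modulo $n$, and $\mathbf{Z}_n^*$ its group of invertible elements. For $X\subseteq\mathbf{Z}_n$ let $a_X=(a_0,a_1,\dots,a_{n-1})$ be the $\{\pm1\}$-row vector with $a_i=-1$ if and only if $i\in X$; $[X]$ denotes the $n\times n$ circulant matrix with first row $a_X$ (i.e. its $(i,j)$ entry is $a_{j-i \bmod n}$). $R$ denotes the $n\times n$ matrix with ones on the back-diagonal and all other entries zero. For $n\times n$ matrices $P_1,P_2,P_3,P_4$ the Goethals--Seidel array is the $4n\times 4n$ matrix $$GS(P_1,P_2,P_3,P_4)=\left[\begin{array}{cccc} P_1 & P_2R & P_3R & P_4R\\ -P_2R & P_1 & -P_4^TR & P_3^TR\\ -P_3R & P_4^TR & P_1 & -P_2^TR\\ -P_4R & -P_3^TR & P_2^TR & P_1\end{array}\right].$$ Let $n=247$ and let $H=\{1,9,16,55,61,81,139,144,235\}$,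 a cyclic subgroup of order $9$ of $\mathbf{Z}_{247}^*$, acting on $\mathbf{Z}_{247}$ by multiplication. Its $30$ nonzero orbits $\alpha_0,\dots,\alpha_{29}$ are enumerated as follows: $\alpha_0=H$, $\alpha_2=\{2,18,31,32,41,110,122,162,223\}$, $\alpha_4=\{3,27,48,165,170,183,185,211,243\}$, $\alpha_6=\{5,28,45,58,80,158,187,201,226\}$, $\alpha_8=\{6,54,83,93,96,119,123,175,239\}$, $\alpha_{10}=\{7,20,63,73,112,138,163,180,232\}$, $\alpha_{12}=\{10,56,69,90,116,127,155,160,205\}$, $\alpha_{14}=\{11,47,99,102,111,115,150,176,177\}$, $\alpha_{16}=\{13,52,65,78,91,117,143,208,221\}$, $\alpha_{18}=\{14,29,40,79,113,126,146,217,224\}$, $\alpha_{20}=\{17,25,43,49,140,142,153,194,225\}$, $\alpha_{22}=\{19,57,171\}$, $\alpha_{24}=\{33,34,37,50,59,86,98,141,203\}$, $\alpha_{26}=\{35,66,68,74,100,118,159,172,196\}$, $\alpha_{28}=\{38,95,114\}$, and $\alpha_{2i+1}=-\alpha_{2i}$ (mod $247$) for $0\le i\le 14$. For $k=1,2,3,4$ set $A_k=\bigcup_{i\in J_k}\alpha_i$ and $B_k=\bigcup_{i\in L_k}\alpha_i$, where $J_1=\{0,2,4,7,8,10,12,15,16,18,20,23,25,27,29\}$, $J_2=\{0,2,7,9,11,12,14,15,16,18,20,22,26\}$, $J_3=\{2,3,4,12,13,14,15,16,18,20,23,24,26,27,29\}$, $J_4=\{0,3,4,6,10,11,12,14,18,19,20,22,25,29\}$,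 $L_1=\{0,3,5,7,8,11,12,15,17,18,21,22,24,27,29\}$, $L_2=\{3,5,6,8,11,13,14,15,16,19,26,27,29\}$, $L_3=\{0,1,2,4,5,7,11,13,14,15,22,23,24,26,27\}$, $L_4=\{0,3,8,9,10,11,13,17,19,24,25,27,28,29\}$. *)

(* Defs.v *)
From mathcomp Require Import all_boot all_order all_algebra.

Set Implicit Arguments.
Unset Strict Implicit.
Unset Printing Implicit Defensive.

Import GRing.Theory.
Local Open Scope ring_scope.

Definition hadamard (m : nat) (A : 'M[int]_m) : Prop :=
  (forall i j, A i j = 1 \/ A i j = -1) /\ A *m A^T = (m%:R)%:M.

Definition skew_symmetric (m : nat) (A : 'M[int]_m) : Prop := A^T = - A.

Definition skew_hadamard (m : nat) (A : 'M[int]_m) : Prop :=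
  hadamard A /\ skew_symmetric (A - 1%:M).

(* 'I_p.+1 carries the additive group structure of the integers modulo p.+1;
   for p.+1 = n > 1 it is convertible to 'Z_n. *)
Definition sign_row (p : nat) (X : {set 'I_p.+1}) : 'rV[int]_p.+1 :=
  \row_i (if i \in X then -1 else 1).

(* The subtraction j - i is modulo p.+1. *)
Definition circulant (p : nat) (a : 'rV[int]_p.+1) : 'M[int]_p.+1 :=
  \matrix_(i, j) a 0 (j - i).

Definition circ_of_set (p : nat) (X : {set 'I_p.+1}) : 'M[int]_p.+1 :=
  circulant (sign_row X).

Definition back_diag (n : nat) : 'M[int]_n :=
  \matrix_(i, j) (j == rev_ord i)%:R.

(* The 4 x 4 array is cut into four 2 x 2 quadrants, listed in the order
   upper left, upper right, lower left, lower right; inside each quadrant,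
   every line of the text is one line of the array. *)
Definition GS (n : nat) (P1 P2 P3 P4 : 'M[int]_n) :
    'M[int]_((n + n) + (n + n)) :=
  let R := back_diag n in
  block_mx
    (block_mx P1              (P2 *m R)
              (- (P2 *m R))   P1)
    (block_mx (P3 *m R)       (P4 *m R)
              (- (P4^T *m R)) (P3^T *m R))
    (block_mx (- (P3 *m R))   (P4^T *m R)
              (- (P4 *m R))   (- (P3^T *m R)))
    (block_mx P1              (- (P2^T *m R))
              (P2^T *m R)     P1).

Definition H247 : seq nat := [:: 1; 9; 16; 55; 61; 81; 139; 144; 235]%N.

(* The i-th entry lists the canonical representatives in [0, 247) of the
   elements of the orbit alpha_(2i) of H247 acting on 'Z_247. *)
Definition even_orbits : seq (seq nat) :=
  [:: H247;
      [:: 2; 18; 31; 32; 41; 110; 122; 162; 223];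
      [:: 3; 27; 48; 165; 170; 183; 185; 211; 243];
      [:: 5; 28; 45; 58; 80; 158; 187; 201; 226];
      [:: 6; 54; 83; 93; 96; 119; 123; 175; 239];
      [:: 7; 20; 63; 73; 112; 138; 163; 180; 232];
      [:: 10; 56; 69; 90; 116; 127; 155; 160; 205];
      [:: 11; 47; 99; 102; 111; 115; 150; 176; 177];
      [:: 13; 52; 65; 78; 91; 117; 143; 208; 221];
      [:: 14; 29; 40; 79; 113; 126; 146; 217; 224];
      [:: 17; 25; 43; 49; 140; 142; 153; 194; 225];
      [:: 19; 57; 171];
      [:: 33; 34; 37; 50; 59; 86; 98; 141; 203];
      [:: 35; 66; 68; 74; 100; 118; 159; 172; 196];
      [:: 38; 95; 114]]%N.

(* i./2 is the integer half of i, so both alpha (2i) and alpha (2i+1) are built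
   from the i-th entry of even_orbits. *)
Definition alpha (i : nat) : {set 'Z_247} :=
  let E := [set x : 'Z_247 | (x : nat) \in nth [::] even_orbits i./2] in
  if odd i then [set - x | x in E] else E.

Definition union_orbits (J : seq nat) : {set 'Z_247} :=
  \bigcup_(i <- J) alpha i.

Definition J1 : seq nat :=
  [:: 0; 2; 4; 7; 8; 10; 12; 15; 16; 18; 20; 23; 25; 27; 29]%N.
Definition J2 : seq nat :=
  [:: 0; 2; 7; 9; 11; 12; 14; 15; 16; 18; 20; 22; 26]%N.
Definition J3 : seq nat :=
  [:: 2; 3; 4; 12; 13; 14; 15; 16; 18; 20; 23; 24; 26; 27; 29]%N.
Definition J4 : seq nat :=
  [:: 0; 3; 4; 6; 10; 11; 12; 14; 18; 19; 20; 22; 25; 29]%N.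

Definition L1 : seq nat :=
  [:: 0; 3; 5; 7; 8; 11; 12; 15; 17; 18; 21; 22; 24; 27; 29]%N.
Definition L2 : seq nat :=
  [:: 3; 5; 6; 8; 11; 13; 14; 15; 16; 19; 26; 27; 29]%N.
Definition L3 : seq nat :=
  [:: 0; 1; 2; 4; 5; 7; 11; 13; 14; 15; 22; 23; 24; 26; 27]%N.
Definition L4 : seq nat :=
  [:: 0; 3; 8; 9; 10; 11; 13; 17; 19; 24; 25; 27; 28; 29]%N.

Definition A1 : {set 'Z_247} := union_orbits J1.
Definition A2 : {set 'Z_247} := union_orbits J2.
Definition A3 : {set 'Z_247} := union_orbits J3.
Definition A4 : {set 'Z_247} := union_orbits J4.

Definition B1 : {set 'Z_247} := union_orbits L1.
Definition B2 : {set 'Z_247} := union_orbits L2.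
Definition B3 : {set 'Z_247} := union_orbits L3.
Definition B4 : {set 'Z_247} := union_orbits L4.

(* Main.v *)
Require Import Defs.
From mathcomp Require Import all_boot all_order all_algebra.
From mathcomp Require Import ring zify.

(** A structural fact about the Goethals-Seidel array reduces the claim to a
    counting property of the four sets modulo n = 247, which is then checked by
    computation.

    Structural part. Circulant matrices commute with each other and with each
    other's transposes, and the back-diagonal matrix R satisfies
    R P^T = P R for every circulant P, so that P R is symmetric. Hence in
    GS GS^T every off-diagonal block is a sum of four terms which cancel in
    pairs, while each diagonal block is the sum of the four P_i P_i^T
    ([GS_mul_tr]). The same symmetry of the P_i R makes GS - I skew-symmetric
    as soon as P_1 - I is ([GS_skew]).

    Combinatorial part. For the circulant of a set X, the (i, k) entry of
    P P^T is n - 2 m, where m counts the j such that exactly one of j and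
    j + (i - k) lies in X ([circ_of_set_mul_tr]). The sum of the four products
    is therefore 4 n I exactly when, for each nonzero shift, the four counts
    add up to 2 n; and P_1 - I is skew-symmetric when X_1 contains exactly one
    element of each pair {d, -d} with d nonzero, and not 0
    ([GS_skew_hadamard]).

    Computation. Membership in the given unions of orbits is computed on
    natural numbers ([in_union_orbits]), so both conditions become tests on
    lists of 247 booleans compared with their rotations
    ([bits_skew_hadamard]), which are evaluated for the two quadruples. *)

Set Implicit Arguments.
Unset Strict Implicit.
Unset Printing Implicit Defensive.

Import GRing.Theory.
Local Open Scope ring_scope.

(** * Circulant matrices and the back-diagonal *)

Lemma tr_back_diag n : (back_diag n)^T = back_diag n.
Proof.
by apply/matrixP=> i j; rewrite !mxE -(inj_eq rev_ord_inj) rev_ordK eq_sym.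
Qed.

Lemma mul_back_diag_l n (P : 'M[int]_n) i j :
  (back_diag n *m P) i j = P (rev_ord i) j.
Proof.
rewrite mxE (bigD1 (rev_ord i)) //= mxE eqxx mul1r big1 ?addr0 // => k ne_k.
by rewrite mxE (negPf ne_k) mul0r.
Qed.

Lemma mul_back_diag_r n (P : 'M[int]_n) i j :
  (P *m back_diag n) i j = P i (rev_ord j).
Proof.
rewrite mxE (bigD1 (rev_ord j)) //= mxE rev_ordK eqxx mulr1.
rewrite big1 ?addr0 // => k ne_k.
by rewrite mxE -(inj_eq rev_ord_inj) rev_ordK eq_sym (negPf ne_k) mulr0.
Qed.

Lemma back_diagK n : back_diag n *m back_diag n = 1%:M.
Proof.
apply/matrixP=> i j; rewrite mul_back_diag_l !mxE rev_ordK.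
by rewrite eq_sym.
Qed.

Definition is_circ p (P : 'M[int]_p.+1) := exists a, P = circulant a.

Lemma is_circ_tr p (P : 'M[int]_p.+1) : is_circ P -> is_circ P^T.
Proof.
case=> a ->; exists (\row_i a 0 (- i)).
by apply/matrixP=> i j; rewrite !mxE opprB.
Qed.

(** Both products are convolutions; the substitution of i + k - j for the
    summation index j exchanges the two factors. *)
Lemma is_circ_comm p (P Q : 'M[int]_p.+1) :
  is_circ P -> is_circ Q -> P *m Q = Q *m P.
Proof.
case=> a -> [b ->]; apply/matrixP=> i k; rewrite !mxE.
rewrite (reindex_inj (inj_comp (addrI (i + k)) oppr_inj)).
apply: eq_bigr => j _; rewrite !mxE /= mulrC; congr (b _ _ * a _ _).
  by rewrite opprB addrCA [i + k]addrC opprD [k + _]addrA subrr add0r.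
by rewrite addrAC [i + k]addrC addrK.
Qed.

(** In the entry (i, k) of P R the argument of the first row of P is
    -1 - k - i modulo n, which is symmetric in i and k. *)
Lemma tr_mul_back_diag p (P : 'M[int]_p.+1) :
  is_circ P -> (P *m back_diag p.+1)^T = P *m back_diag p.+1.
Proof.
case=> a ->; apply/matrixP=> i k.
rewrite trmx_mul tr_back_diag mul_back_diag_l mul_back_diag_r !mxE.
congr (a _ _); apply: val_inj; rewrite /= !modnDmr.
by congr (_ %% _)%N; have := ltn_ord i; have := ltn_ord k; lia.
Qed.

Lemma mul_back_diag_tr p (P Q : 'M[int]_p.+1) :
  is_circ Q -> P *m back_diag p.+1 *m Q^T = P *m Q *m back_diag p.+1.
Proof.
by move/tr_mul_back_diag; rewrite trmx_mul tr_back_diag -!mulmxA => ->.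
Qed.

Lemma mul_back_diag2 p (P Q : 'M[int]_p.+1) : is_circ Q ->
  P *m back_diag p.+1 *m (Q *m back_diag p.+1) = P *m Q^T.
Proof.
by move/tr_mul_back_diag<-; rewrite trmx_mul tr_back_diag -mulmxA
  (mulmxA (back_diag _)) back_diagK mul1mx.
Qed.

(** * The Goethals-Seidel array *)

(** After the factors R are moved to the right, where they cancel in pairs or
    leave one common factor, the blocks are signed sums of products of
    commuting matrices. *)
Lemma GS_mul_tr p (P1 P2 P3 P4 : 'M[int]_p.+1) (c : int) :
  is_circ P1 -> is_circ P2 -> is_circ P3 -> is_circ P4 ->
  P1 *m P1^T + P2 *m P2^T + P3 *m P3^T + P4 *m P4^T = c%:M ->
  GS P1 P2 P3 P4 *m (GS P1 P2 P3 P4)^T = c%:M.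
Proof.
move=> c1 c2 c3 c4 sumP.
have [t1 t2] := (is_circ_tr c1, is_circ_tr c2).
have [t3 t4] := (is_circ_tr c3, is_circ_tr c4).
have trN (X : 'M[int]_p.+1) : (- X)^T = - X^T by rewrite linearN.
have symR := (trN, tr_mul_back_diag c2, tr_mul_back_diag c3,
  tr_mul_back_diag c4, tr_mul_back_diag t2, tr_mul_back_diag t3,
  tr_mul_back_diag t4).
have prodR X := (mul_back_diag_tr X c1, mul_back_diag2 X c2,
  mul_back_diag2 X c3, mul_back_diag2 X c4, mul_back_diag2 X t2,
  mul_back_diag2 X t3, mul_back_diag2 X t4).
(* Each product is put in the order P1, P2, P2^T, P3, P3^T, P4, P4^T, which
   makes equal products syntactically equal. *)
have comm := is_circ_comm.
have order1 := (comm _ _ _ c2 c1, comm _ _ _ c3 c1, comm _ _ _ c4 c1,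
  comm _ _ _ t2 c1, comm _ _ _ t3 c1, comm _ _ _ t4 c1).
have order2 := (comm _ _ _ t2 c2, comm _ _ _ c3 c2, comm _ _ _ t3 c2,
  comm _ _ _ c4 c2, comm _ _ _ t4 c2, comm _ _ _ c3 t2, comm _ _ _ t3 t2,
  comm _ _ _ c4 t2, comm _ _ _ t4 t2).
have order3 := (comm _ _ _ t3 c3, comm _ _ _ c4 c3, comm _ _ _ t4 c3,
  comm _ _ _ c4 t3, comm _ _ _ t4 t3, comm _ _ _ t4 c4).
rewrite /GS !tr_block_mx !mulmx_block !scalar_mx_block !symR.
congr block_mx; rewrite add_block_mx -?block_mx0; congr block_mx.
all: rewrite ?(mulNmx, mulmxN) ?prodR ?trmxK ?mulmxA ?(order1, order2, order3).
(* What remains is an identity of abelian groups, checked on entries. *)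
all: rewrite -?sumP; apply/matrixP=> i j; rewrite !mxE; ring.
Qed.

Lemma GS_skew p (P1 P2 P3 P4 : 'M[int]_p.+1) :
  is_circ P2 -> is_circ P3 -> is_circ P4 ->
  skew_symmetric (P1 - 1%:M) -> skew_symmetric (GS P1 P2 P3 P4 - 1%:M).
Proof.
rewrite /skew_symmetric => c2 c3 c4 skewP.
have [t3 t4] := (is_circ_tr c3, is_circ_tr c4); have t2 := is_circ_tr c2.
have trN m (X : 'M[int]_m) : (- X)^T = - X^T by rewrite linearN.
rewrite /GS !scalar_mx_block !opp_block_mx !add_block_mx !oppr0 !addr0.
rewrite !tr_block_mx skewP !trN.
rewrite !tr_mul_back_diag //.
by rewrite !opp_block_mx !opprK.
Qed.

Definition sign_mx m n (M : 'M[int]_(m, n)) :=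
  forall i j, M i j = 1 \/ M i j = -1.

Lemma sign_mx_opp m n (M : 'M[int]_(m, n)) : sign_mx M -> sign_mx (- M).
Proof. by move=> sM i j; rewrite mxE; case: (sM i j) => ->; [right | left]. Qed.

Lemma sign_mx_tr m n (M : 'M[int]_(m, n)) : sign_mx M -> sign_mx M^T.
Proof. by move=> sM i j; rewrite mxE. Qed.

Lemma sign_mx_back_diag n (M : 'M[int]_n) :
  sign_mx M -> sign_mx (M *m back_diag n).
Proof. by move=> sM i j; rewrite mul_back_diag_r. Qed.

Lemma sign_mx_block m1 m2 n1 n2 (A : 'M[int]_(m1, n1)) B C
    (D : 'M[int]_(m2, n2)) :
  sign_mx A -> sign_mx B -> sign_mx C -> sign_mx D ->
  sign_mx (block_mx A B C D).
Proof.
by move=> sA sB sC sD i j; rewrite mxE; case: split => k; rewrite mxE;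
  case: split => l.
Qed.

Lemma GS_sign n (P1 P2 P3 P4 : 'M[int]_n) :
  sign_mx P1 -> sign_mx P2 -> sign_mx P3 -> sign_mx P4 ->
  sign_mx (GS P1 P2 P3 P4).
Proof.
move=> s1 s2 s3 s4; rewrite /GS.
do 2!apply: sign_mx_block.
all: try apply: sign_mx_opp; try apply: sign_mx_back_diag.
all: by [|apply: sign_mx_tr].
Qed.

(** * Circulants of sets *)

(** The j at which the indicator of X changes under the shift by d: the
    indices that contribute -1 to the periodic autocorrelation of the sign row
    of X at d. *)
Definition boundary p (X : {set 'I_p.+1}) (d : 'I_p.+1) :=
  [set j | (j \in X) != (j + d \in X)].

Lemma circ_of_set_mul_tr p (X : {set 'I_p.+1}) i k :
  (circ_of_set X *m (circ_of_set X)^T) i k =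
    p.+1%:R - (2 * #|boundary X (i - k)|)%:R.
Proof.
rewrite mxE (reindex_inj (addIr i)) /=.
have -> : p.+1%:R = \sum_(j < p.+1) 1 :> int.
  by rewrite sumr_const card_ord.
rewrite -sum1_card mulnC big_distrl /= natr_sum [X in _ - X]big_mkcond -sumrB.
apply: eq_bigr => j _; rewrite !mxE addrK inE -addrA.
by case: (j \in X); case: (_ \in X).
Qed.

Lemma circ_of_set_sign p (X : {set 'I_p.+1}) : sign_mx (circ_of_set X).
Proof. by move=> i j; rewrite !mxE; case: ifP; [right | left]. Qed.

Lemma circ_of_set_skew p (X : {set 'I_p.+1}) :
  0 \notin X -> (forall d : 'I_p.+1, d != 0 -> (- d \in X) = (d \notin X)) ->
  skew_symmetric (circ_of_set X - 1%:M).
Proof.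
move=> X0 skewX; apply/matrixP=> i j; rewrite !mxE -(opprB j i) eq_sym.
have [->|ne_ij] := eqVneq i j; first by rewrite subrr oppr0 (negPf X0).
by rewrite !subr0 skewX ?subr_eq0 1?eq_sym //; case: (_ \in X).
Qed.

(** On the diagonal the boundaries are those of the shift 0, hence empty, and
    the four products contribute n each; elsewhere they cancel by the counting
    hypothesis. *)
Lemma GS_skew_hadamard p (X1 X2 X3 X4 : {set 'I_p.+1}) :
  0 \notin X1 -> (forall d : 'I_p.+1, d != 0 -> (- d \in X1) = (d \notin X1)) ->
  (forall d : 'I_p.+1, d != 0%R ->
     #|boundary X1 d| + #|boundary X2 d| + #|boundary X3 d| + #|boundary X4 d|
       = p.+1.*2)%N ->
  skew_hadamard (GS (circ_of_set X1) (circ_of_set X2)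
                    (circ_of_set X3) (circ_of_set X4)).
Proof.
move=> X0 skewX bX.
have circX X : is_circ (circ_of_set X) by exists (sign_row X).
have signX := circ_of_set_sign.
split; last by apply: GS_skew; rewrite //; apply: circ_of_set_skew.
split; first exact: GS_sign.
apply: GS_mul_tr => //; apply/matrixP=> i k.
rewrite 3!mxE !circ_of_set_mul_tr [RHS]mxE.
have [->|ne_ik] := eqVneq i k.
  have b0 X : boundary X (k - k) = set0.
    by apply/setP=> j; rewrite !inE subrr addr0 eqxx.
  by rewrite !b0 cards0 !subr0 -!natrD mulr1n !addnA.
rewrite mulr0n; have := bX (i - k).
rewrite subr_eq0 => /(_ ne_ik); lia.
Qed.

(** * Reduction to lists of booleans *)

Definition mismatches (s : seq bool) d :=
  count (fun bc => bc.1 != bc.2) (zip s (rot d s)).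

(** Rotating the list of bits by d is the translation by d modulo its
    length. *)
Lemma card_boundary p (X : {set 'I_p.+1}) (b : nat -> bool) (d : 'I_p.+1) :
  (forall x : 'I_p.+1, (x \in X) = b x) ->
  #|boundary X d| = mismatches (mkseq b p.+1) d.
Proof.
move=> Xb; have le_dp : (d <= p.+1)%N by apply: ltnW.
rewrite /mismatches; have -> : zip (mkseq b p.+1) (rot d (mkseq b p.+1)) =
    [seq (b k, b ((k + d) %% p.+1)%N) | k <- iota 0 p.+1].
  apply: (@eq_from_nth _ (false, false)).
    by rewrite size_zip size_rot !size_map size_iota minnn.
  move=> k; rewrite size_zip size_rot size_mkseq minnn => lt_kp.
  rewrite nth_zip ?size_rot // (nth_map 0%N) ?size_iota // nth_iota // add0n.
  rewrite nth_mkseq //; congr (_, _).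
  rewrite /rot nth_cat size_drop size_mkseq; case: ltnP => [lt_k|le_k].
    by rewrite nth_drop nth_mkseq ?modn_small 1?addnC //; lia.
  rewrite nth_take ?nth_mkseq; [congr b | lia | lia].
  have -> : (k + d = (k - (p.+1 - d)) + p.+1)%N by lia.
  by rewrite modnDr modn_small //; lia.
rewrite count_map -val_enum_ord count_map cardE -size_filter.
rewrite enumT /enum_mem; congr size; apply: eq_filter => k.
by rewrite /= inE !Xb.
Qed.

(** The hypotheses of [GS_skew_hadamard] as one boolean. The bits are tabulated
    first, so that evaluation computes each of them only once. *)
Definition bits_certificate p (b1 b2 b3 b4 : nat -> bool) :=
  let n := p.+1 in
  let s1 := mkseq b1 n in let s2 := mkseq b2 n in
  let s3 := mkseq b3 n in let s4 := mkseq b4 n in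
  [&& ~~ nth false s1 0,
      all (fun d => nth false s1 (n - d) == ~~ nth false s1 d) (iota 1 p)
    & all (fun d => mismatches s1 d + mismatches s2 d +
                    mismatches s3 d + mismatches s4 d == n.*2)%N (iota 1 p)].

Lemma bits_skew_hadamard p (X1 X2 X3 X4 : {set 'I_p.+1})
    (b1 b2 b3 b4 : nat -> bool) :
  (forall x : 'I_p.+1, (x \in X1) = b1 x) ->
  (forall x : 'I_p.+1, (x \in X2) = b2 x) ->
  (forall x : 'I_p.+1, (x \in X3) = b3 x) ->
  (forall x : 'I_p.+1, (x \in X4) = b4 x) ->
  bits_certificate p b1 b2 b3 b4 ->
  skew_hadamard (GS (circ_of_set X1) (circ_of_set X2)
                    (circ_of_set X3) (circ_of_set X4)).
Proof.
move=> Xb1 Xb2 Xb3 Xb4 /and3P[b10 /allP skewb /allP mism].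
have rangeP (d : 'I_p.+1) : d != 0 -> (d : nat) \in iota 1 p.
  by rewrite mem_iota add1n ltn_ord andbT lt0n.
apply: GS_skew_hadamard => [|d d0|d /rangeP].
- by rewrite Xb1; rewrite nth_mkseq in b10.
- have d_gt0 : (0 < d)%N by rewrite lt0n.
  have := skewb d (rangeP d d0); rewrite !nth_mkseq ?ltn_ord //; last by lia.
  by rewrite !Xb1 /= modn_small => [/eqP|]; last by lia.
by move/mism/eqP; rewrite !(card_boundary _ Xb1, card_boundary _ Xb2,
  card_boundary _ Xb3, card_boundary _ Xb4).
Qed.

(** * The orbits modulo 247 *)

Definition orbit_bits (J : seq nat) (x : nat) : bool :=
  has (fun i => (if odd i then (247 - x) %% 247 else x)%N
                  \in nth [::] even_orbits i./2) J.

Lemma in_union_orbits J (x : 'Z_247) :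
  (x \in union_orbits J) = orbit_bits J x.
Proof.
rewrite /union_orbits /orbit_bits; elim: J => [|i J IHJ].
  by rewrite big_nil inE.
rewrite big_cons inE IHJ /= /alpha; congr (_ || _).
case: ifP => _; last by rewrite inE.
by rewrite -{1}[x]opprK mem_imset ?inE //; apply: oppr_inj.
Qed.

Lemma union_orbits_skew_hadamard K1 K2 K3 K4 :
  bits_certificate 246 (orbit_bits K1) (orbit_bits K2)
                       (orbit_bits K3) (orbit_bits K4) ->
  @skew_hadamard 988
    (@GS 247 (circ_of_set (union_orbits K1)) (circ_of_set (union_orbits K2))
             (circ_of_set (union_orbits K3)) (circ_of_set (union_orbits K4))).
Proof.
exact: bits_skew_hadamard (in_union_orbits _) (in_union_orbits _)
  (in_union_orbits _) (in_union_orbits _).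
Qed.

Theorem proposition4p2 :
  @skew_hadamard 988
    (@GS 247 (circ_of_set A1) (circ_of_set A2) (circ_of_set A3) (circ_of_set A4))
  /\
  @skew_hadamard 988
    (@GS 247 (circ_of_set B1) (circ_of_set B2) (circ_of_set B3) (circ_of_set B4)).
Proof.
split; apply: union_orbits_skew_hadamard; by vm_compute.
Qed.
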